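(* Let $\pi=(d_{1},\ldots,d_{n})$ be a non-increasing positive graphic sequence with $n$ even, and let $k$ be a positive integer with $k\leq d_{n}$. If \[d_{d_{1}-d_{n}+k}\geq d_{1}-d_{n}+k-1,\] then some realization of $\pi$ has $k$ pairwise edge-disjoint $1$-factors.
   Context: All graphs are finite, simple (no loops, no multi-edges). A sequence of nonnegative integers is graphic if it is the degree sequence of some simple graph, called a realization of it. A sequence is non-increasing if $d_1\ge\cdots\ge d_n$ and positive if every $d_i\ge 1$. A $1$-factor (perfect matching) of a graph is a spanning $1$-regular subgraph. *)

(* Defs.v *)
From HB Require Import structures.
From mathcomp Require Import all_boot.

Set Implicit Arguments.
Unset Strict Implicit.
Unset Printing Implicit Defensive.

Record sgraph (V : finType) := SGraph {
  adj :> rel V;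
  adj_sym : symmetric adj;
  adj_irrefl : irreflexive adj
}.

Section Graphs.
Variable V : finType.
Implicit Types G F : sgraph V.

Definition degree G (v : V) : nat := #|[set w | G v w]|.

Definition spanning_subgraph F G : Prop := forall x y, F x y -> G x y.

Definition regular_of_degree r G : Prop := forall v, degree G v = r.

Definition one_factor F G : Prop :=
  spanning_subgraph F G /\ regular_of_degree 1 F.

Definition edge_disjoint F1 F2 : Prop := forall x y, ~~ (F1 x y && F2 x y).

Definition has_disjoint_one_factors (k : nat) G : Prop :=
  exists F : 'I_k -> sgraph V,
    (forall i, one_factor (F i) G) /\
    (forall i j, i != j -> edge_disjoint (F i) (F j)).

(* The vertices of V come in no preferred order, so the degree sequence is
   only determined up to permutation. *)
Definition realization G (s : seq nat) : Prop :=
  perm_eq [seq degree G v | v <- enum V] s.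

End Graphs.

Definition graphic (s : seq nat) : Prop :=
  exists (V : finType) (G : sgraph V), realization G s.

(* [entry s i] is the i-th term counting from 1; it is only meaningful for
   1 <= i <= size s. *)
Definition entry (s : seq nat) (i : nat) : nat := nth 0 s i.-1.

(* Main.v *)
(* Induct on the number of 1-factors: given m < k disjoint 1-factors, take a
   realization in which a further disjoint matching M is as large as possible,
   and suppose that it misses u and v, where d(v) <= d(u) and d(u) + d(v) is
   maximal over all such configurations.

   For vertices p, q and a set U of other vertices, exchanging the edges pt and
   qt for all t in U (with their membership in the 1-factors and in M) changes
   nothing at the vertices of U, and the 1-factors survive as soon as each one
   is met equally often on both sides.  Such sets U arise by following an edge
   qt of a 1-factor to the edge pt' of the same 1-factor, so the 1-factors are
   transparent for edge exchanges.  In particular, if M misses p, then M can be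
   changed so as to miss q instead of p whenever d(q) <= d(p).

   Let W be the set of vertices w <> u with d(w) <= d(v), A the set of the
   other vertices apart from u, and A0 the set of the vertices of A joined to W
   by an edge lying in no 1-factor and not in M; for x in A0 let low(x) be the
   number of these edges.  By maximality such edges do not occur inside
   W + u, the vertices of A0 are adjacent to all of A and matched by M into W,
   and d(x) >= |A| + low(x) and d(x) >= d(u) + 1 + low(x) for x in A0.  Since
   |W| > |A0|, summing over A0 gives |A| < l and d(u) + 1 < l with
   l = d_1 - d_n + k, so all vertices of degree at least l - 1 lie in A, although
   by hypothesis there are at least l of them. *)
Require Import Defs.
From HB Require Import structures.
From mathcomp Require Import all_boot perm.
From mathcomp Require Import zify.
From Stdlib Require Import Classical_Prop.

Set Implicit Arguments.
Unset Strict Implicit.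
Unset Printing Implicit Defensive.

(** * Maxima, level sets and the handshake lemma *)

Lemma exists_max_nat (P : nat -> Prop) (B : nat) :
  (exists n, P n) -> (forall n, P n -> n <= B) ->
  exists2 n, P n & forall n', P n' -> n' <= n.
Proof.
move=> [n Pn] PB.
elim: {n}(B - n) {-2}n (leqnn (B - n)) Pn => [|j IH] n nB Pn.
  exists n => // n' /PB; lia.
have [[n' Pn' lt_nn']|no] := classic (exists2 n', P n' & n < n').
  by apply: (IH n') => //; have := PB _ Pn'; lia.
exists n => // n' Pn'; rewrite leqNgt; apply/negP => lt_nn'.
by apply: no; exists n'.
Qed.

Lemma card_level_sets (T : finType) (U : {set T}) (f : T -> nat) (P : pred nat)
    (b : nat) :
  (forall t, f t < b) ->
  #|[set t in U | P (f t)]| = \sum_(i < b | P i) #|[set t in U | f t == i]|.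
Proof.
move=> fb; rewrite -sum1_card.
rewrite (partition_big (fun t => Ordinal (fb t)) (fun i => P i)) /=; last first.
  by move=> t; rewrite inE => /andP[].
apply: eq_bigr => i Pi; rewrite -sum1_card; apply: eq_bigl => t.
rewrite !inE -val_eqE /=; case: eqP => [->|_]; last by rewrite !andbF.
by rewrite Pi !andbT.
Qed.

(** Each edge is counted once per orientation; [enum_rank] tells the orientations apart, and
    symmetry makes the two counts equal. *)
Lemma even_sum_degrees (T : finType) (r : rel T) :
  symmetric r -> irreflexive r -> ~~ odd (\sum_x #|[set y | r x y]|).
Proof.
move=> r_sym r_irr.
have -> : \sum_x #|[set y | r x y]| =
    (\sum_x \sum_y (r x y && (enum_rank x < enum_rank y))) +
    (\sum_x \sum_y (r x y && (enum_rank y < enum_rank x))).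
  rewrite -big_split; apply: eq_bigr => x _ /=.
  rewrite -big_split -sum1_card big_mkcond; apply: eq_bigr => y _ /=.
  rewrite inE; case rxy: (r x y) => //=.
  case: ltngtP => // /val_inj /enum_rank_inj xy.
  by rewrite xy r_irr in rxy.
rewrite [X in _ + X]exchange_big /=.
set s1 := \sum_x _; set s2 := \sum_x _.
suff -> : s2 = s1 by rewrite addnn odd_double.
by apply: eq_bigr => x _; apply: eq_bigr => y _; rewrite r_sym.
Qed.

(** * Alternating walks *)

(* [f t] and [g t] stand for the colours of the edges [p t] and [q t]. *)
Section Reach.

Variables (T : finType) (Z : {set T}) (f g : T -> nat) (b : nat).
Hypothesis f_lt : forall t, f t < b.
Hypothesis g_lt : forall t, g t < b.
Hypothesis f_neq2 : forall t, t \in Z -> f t != 2.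
Hypothesis f_le1 : forall i, 2 < i -> #|[set t in Z | f t == i]| <= 1.
Hypothesis fg_card : forall i, 2 < i ->
  #|[set t in Z | f t == i]| = #|[set t in Z | g t == i]|.

(** As [f] avoids 2 on [Z], a step can only follow a colour above 2, that of a 1-factor. *)
Definition next : rel T :=
  [rel t t' | [&& t \in Z, t' \in Z, 1 < g t & g t == f t']].

Definition reach (S : {set T}) : {set T} :=
  [set t | [exists s in S, connect next s t]].

Lemma reach_incl (S : {set T}) : S \subset reach S.
Proof.
by apply/subsetP => s sS; rewrite inE; apply/existsP; exists s; rewrite sS connect0.
Qed.

Lemma reach_split (S : {set T}) t : t \in reach S ->
  exists2 s, s \in S & t \in reach [set s].
Proof.
rewrite inE => /existsP[s /andP[sS st]]; exists s => //.
by rewrite inE; apply/existsP; exists s; rewrite inE eqxx.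
Qed.

(** Discarding the levels above 2, of equal sizes for [f] and [g], leaves equally many elements; for
    [f] these have colour 0 or 1. *)
Lemma card_balanced_ends (U : {set T}) : U \subset Z ->
  (forall i, 2 < i -> #|[set t in U | f t == i]| = #|[set t in U | g t == i]|) ->
  #|[set t in U | g t <= 2]| = #|[set t in U | f t <= 1]|.
Proof.
move=> UZ bal.
have cardE h : #|U| = #|[set t in U | h t <= 2]| + #|[set t in U | 2 < h t]|.
  rewrite -(cardsID [set t | h t <= 2] U); congr (_ + _).
    by apply: eq_card => t; rewrite !inE.
  by apply: eq_card => t; rewrite !inE -ltnNge andbC.
have /eqP := cardE f; rewrite (cardE g).
rewrite (card_level_sets U (ltn 2) f_lt) (card_level_sets U (ltn 2) g_lt).
under [X in _ == _ + X]eq_bigr => i i_gt2 do rewrite bal //.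
rewrite eqn_add2r => /eqP ->; apply: eq_card => t.
rewrite !inE; case tU: (t \in U) => //=.
have /f_neq2 : t \in Z by apply: (subsetP UZ).
lia.
Qed.

Section Starts.
Variable S : {set T}.
Hypothesis S_start : S \subset [set t in Z | f t <= 1].

Lemma reach_sub : reach S \subset Z.
Proof.
apply/subsetP => t; rewrite inE => /existsP[s /andP[sS /connectP[p]]].
have sZ : s \in Z by move/subsetP: S_start => /(_ _ sS); rewrite inE => /andP[].
elim/last_ind: p => [|p y _]; first by move=> _ ->.
by rewrite rcons_path last_rcons => /andP[_ /and4P[_ yZ _ _]] ->.
Qed.

Lemma reach_starts : [set t in reach S | f t <= 1] = S.
Proof.
apply/setP => t; rewrite inE; apply/andP/idP => [[]|tS]; last first.
  split; first exact: (subsetP (reach_incl S)).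
  by move/subsetP: S_start => /(_ _ tS); rewrite inE => /andP[].
rewrite inE => /existsP[s /andP[sS /connectP[p]]].
elim/last_ind: p => [|p y _]; first by move=> _ ->.
rewrite rcons_path last_rcons => /andP[_ /and4P[_ _ g_gt1 /eqP gf]] -> f_le.
by move: g_gt1; rewrite gf ltnNge f_le.
Qed.

(** On [Z] each such level has at most one element. One of level [i] for [f] is no start, so its
    predecessor has level [i] for [g]; one of level [i] for [g] has a successor, which is reached
    too. *)
Lemma reach_balanced i : 2 < i ->
  #|[set t in reach S | f t == i]| = #|[set t in reach S | g t == i]|.
Proof.
move=> i_gt2.
have sub h : [set t in reach S | h t == i] \subset [set t in Z | h t == i].
  apply/subsetP => t; rewrite 2!inE => /andP[tU ->].
  by rewrite (subsetP reach_sub).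
have lef := leq_trans (subset_leq_card (sub f)) (f_le1 i_gt2).
have leg : #|[set t in reach S | g t == i]| <= 1.
  by apply: leq_trans (subset_leq_card (sub g)) _; rewrite -fg_card // f_le1.
suff: (0 < #|[set t in reach S | f t == i]|) = (0 < #|[set t in reach S | g t == i]|).
  by move: lef leg; case: #|_| => [|[|?]] //; case: #|_| => [|[|?]].
apply/card_gt0P/card_gt0P => -[t]; rewrite inE => /andP[tU /eqP t_i].
  have [p pU]: exists2 t', t' \in reach S & next t' t.
    move: (tU); rewrite inE => /existsP[s /andP[sS /connectP[p]]].
    elim/last_ind: p => [/= _ ts|p y _].
      move/subsetP: S_start => /(_ _ sS); rewrite inE -ts t_i; lia.
    rewrite rcons_path last_rcons => /andP[sp yt] ->.
    exists (last s p) => //; rewrite inE; apply/existsP.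
    by exists s; rewrite sS; apply/connectP; exists p.
  case/and4P=> _ _ _ /eqP gf; exists p.
  by rewrite inE pU gf t_i eqxx.
have tZ := subsetP reach_sub _ tU.
have: 0 < #|[set t' in Z | f t' == i]|.
  by rewrite fg_card //; apply/card_gt0P; exists t; rewrite inE tZ t_i eqxx.
case/card_gt0P=> t'; rewrite inE => /andP[t'Z /eqP ft'].
exists t'; rewrite inE ft' eqxx andbT inE.
move: tU; rewrite inE => /existsP[s /andP[sS st]].
apply/existsP; exists s; rewrite sS; apply: (connect_trans st).
by apply: connect1; rewrite /next /= tZ t'Z t_i ft' eqxx; lia.
Qed.

Lemma card_reach_ends : #|[set t in reach S | g t <= 2]| = #|S|.
Proof.
rewrite (card_balanced_ends reach_sub); last exact: reach_balanced.
by rewrite reach_starts.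
Qed.

End Starts.

(** Counting replaces backtracking: the ends reached from all starts are as many as the starts,
    hence as many as all ends in [Z]. *)
Lemma reach_end t : t \in Z -> g t <= 2 ->
  exists2 s, s \in [set s in Z | f s <= 1] & t \in reach [set s].
Proof.
move=> tZ gt; set S := [set s in Z | f s <= 1].
have Sle : S \subset S by [].
have sub : [set t in reach S | g t <= 2] \subset [set t in Z | g t <= 2].
  by apply/subsetP => t'; rewrite 2!inE => /andP[/(subsetP (reach_sub Sle)) -> ->].
have /eqP Uends : [set t in reach S | g t <= 2] == [set t in Z | g t <= 2].
  by rewrite eqEcard sub card_reach_ends // (card_balanced_ends (subxx Z) fg_card) leqnn.
have : t \in [set t in reach S | g t <= 2] by rewrite Uends inE tZ.
by case/setIdP=> /reach_split.
Qed.

End Reach.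

(** * Colourings and exchanges *)

Definition cdeg (V : finType) (c : V -> V -> nat) (i : nat) (x : V) : nat :=
  #|[set y | c x y == i]|.

(* Colour 0 marks the pairs that are not edges (and the diagonal), colour 2 the
   matching M, colours 3 .. m + 2 the 1-factors, and colour 1 all other edges. *)
Record coloring (V : finType) (D : V -> nat) (m : nat) (c : V -> V -> nat) : Prop :=
  Coloring {
  col_sym : forall x y, c x y = c y x;
  col_diag : forall x, c x x = 0;
  col_lt : forall x y, c x y < m + 3;
  col_deg0 : forall x, cdeg c 0 x + D x = #|V|;
  col_perfect : forall x i, 2 < i < m + 3 -> cdeg c i x = 1;
  col_matching : forall x, cdeg c 2 x <= 1
}.

(** For [U] avoiding [p] and [q] this exchanges the colours of [p t] and [q t] for [t] in [U].
    Transposing one coordinate when the other lies in [U] inherits symmetry from [c]. *)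
Definition swap_colors (V : finType) (c : V -> V -> nat) (p q : V) (U : {set V})
    (x y : V) : nat :=
  c (if y \in U then tperm p q x else x) (if x \in U then tperm p q y else y).

Section Swap.

Variables (V : finType) (c : V -> V -> nat).
Hypothesis c_sym : forall x y, c x y = c y x.

Lemma swap_colors_sym p q U x y :
  swap_colors c p q U x y = swap_colors c p q U y x.
Proof. by rewrite /swap_colors c_sym. Qed.

Lemma swap_colorsC p q U x y : swap_colors c p q U x y = swap_colors c q p U x y.
Proof. by rewrite /swap_colors tpermC. Qed.

Variables (p q : V) (U : {set V}).
Hypothesis UZ : U \subset ~: [set p; q].

Lemma swap_U_neq t : t \in U -> (t != p) && (t != q).
Proof. by move/(subsetP UZ); rewrite !inE negb_or. Qed.

Lemma swap_p_notin : p \notin U.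
Proof. by apply/negP => /swap_U_neq; rewrite eqxx. Qed.

Lemma swap_q_notin : q \notin U.
Proof. by apply/negP => /swap_U_neq; rewrite eqxx andbF. Qed.

Lemma swap_colors_p t :
  swap_colors c p q U p t = if t \in U then c q t else c p t.
Proof. by rewrite /swap_colors tpermL (negbTE swap_p_notin); case: ifP. Qed.

Lemma swap_colors_q t :
  swap_colors c p q U q t = if t \in U then c p t else c q t.
Proof. by rewrite /swap_colors tpermR (negbTE swap_q_notin); case: ifP. Qed.

Lemma swap_colors_out x y : x != p -> x != q -> y != p -> y != q ->
  swap_colors c p q U x y = c x y.
Proof.
move=> xp xq yp yq; rewrite /swap_colors.
by rewrite !tpermD 1?eq_sym // !if_same.
Qed.

Lemma cdeg_swap_out i x : x != p -> x != q ->
  cdeg (swap_colors c p q U) i x = cdeg c i x.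
Proof.
move=> xp xq; rewrite /cdeg /swap_colors tpermD 1?eq_sym //.
case: (boolP (x \in U)) => _; last by apply: eq_card => y; rewrite !inE if_same.
rewrite -[RHS](card_preimset _ (@perm_inj _ (tperm p q))).
by apply: eq_card => y; rewrite !inE if_same.
Qed.

Lemma cdeg_swap_p i :
  cdeg (swap_colors c p q U) i p + #|[set t in U | c p t == i]| =
  cdeg c i p + #|[set t in U | c q t == i]|.
Proof.
rewrite /cdeg.
rewrite -(cardsID U [set y | swap_colors c p q U p y == i]).
rewrite -(cardsID U [set y | c p y == i]).
rewrite (_ : [set y | swap_colors c p q U p y == i] :&: U = [set t in U | c q t == i]).
  rewrite (_ : [set y | swap_colors c p q U p y == i] :\: U = [set y | c p y == i] :\: U).
    rewrite (_ : [set y | c p y == i] :&: U = [set t in U | c p t == i]); first lia.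
    by apply/setP => y; rewrite !inE andbC.
  by apply/setP => y; rewrite !inE swap_colors_p; case: ifP.
by apply/setP => y; rewrite !inE swap_colors_p andbC; case: ifP.
Qed.

End Swap.

Lemma cdeg_swap_q (V : finType) (c : V -> V -> nat) p q (U : {set V}) i :
  (forall x y, c x y = c y x) -> U \subset ~: [set p; q] ->
  cdeg (swap_colors c p q U) i q + #|[set t in U | c q t == i]| =
  cdeg c i q + #|[set t in U | c p t == i]|.
Proof.
move=> c_sym; rewrite setUC => UZ; rewrite -(cdeg_swap_p c UZ).
by congr (_ + _); apply: eq_card => y; rewrite !inE swap_colorsC.
Qed.

Section Coloring.

Variables (V : finType) (D : V -> nat) (m : nat).
Implicit Types (c : V -> V -> nat).

Lemma coloring_degree c x : coloring D m c -> D x = cdeg c 1 x + cdeg c 2 x + m.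
Proof.
move=> cc; have := col_deg0 cc x.
have : #|V| = \sum_(i < m + 3) cdeg c i x.
  rewrite -cardsT (_ : setT = [set y in [set: V] | xpredT (c x y)]).
    rewrite (card_level_sets [set: V] xpredT (col_lt cc x)).
    by apply: eq_bigr => i _; apply: eq_card => y; rewrite !inE.
  by apply/setP => y; rewrite !inE.
rewrite addn3 !big_ord_recl /=.
under eq_bigr => i _.
  rewrite (col_perfect cc); last by rewrite /bump /=; have := ltn_ord i; lia.
over.
rewrite sum1_card card_ord /bump !add1n; lia.
Qed.

(** Only colours 1 and 2 may be unbalanced on [U], so beyond the balance only the matching condition
    at [p] and [q] is at stake. *)
Lemma coloring_swap c p q (U : {set V}) : coloring D m c -> p != q ->
  U \subset ~: [set p; q] ->
  (forall i, (i == 0) || (2 < i) ->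
     #|[set t in U | c p t == i]| = #|[set t in U | c q t == i]|) ->
  cdeg (swap_colors c p q U) 2 p <= 1 -> cdeg (swap_colors c p q U) 2 q <= 1 ->
  coloring D m (swap_colors c p q U).
Proof.
move=> cc pq UZ bal p2 q2.
have bal_deg i x : (i == 0) || (2 < i) -> cdeg (swap_colors c p q U) i x = cdeg c i x.
  move=> hi; have [->|xp] := eqVneq x p.
    by have := cdeg_swap_p c UZ i; rewrite bal //; lia.
  have [->|xq] := eqVneq x q.
    by have := cdeg_swap_q i (col_sym cc) UZ; rewrite bal //; lia.
  by rewrite cdeg_swap_out.
split=> [x y|x|x y|x|x i /andP[i2 im]|x].
- by rewrite swap_colors_sym //; apply: (col_sym cc).
- by rewrite /swap_colors (col_diag cc).
- exact: (col_lt cc).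
- by rewrite bal_deg //; apply: (col_deg0 cc).
- by rewrite bal_deg ?i2 ?orbT //; apply: (col_perfect cc); rewrite i2.
- have [->|xp] := eqVneq x p; first by [].
  have [->|xq] := eqVneq x q; first by [].
  by rewrite cdeg_swap_out //; apply: (col_matching cc).
Qed.

Section Paths.

Variables (c : V -> V -> nat) (p q : V).
Hypothesis cc : coloring D m c.
Hypothesis pq : p != q.
Hypothesis p_missed : cdeg c 2 p = 0.

Let Z := ~: [set p; q].

Lemma path_neq2 t : t \in Z -> c p t != 2.
Proof.
move=> _; apply/negP => /eqP pt; move: p_missed; rewrite /cdeg => /eqP.
by rewrite cards_eq0 => /eqP/setP/(_ t); rewrite !inE pt.
Qed.

(** One proof serves both ends, [x] and [y] being [p] and [q] in either order; the extra summand is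
    the pair [p q] itself. *)
Lemma card_setZ i x (y : V) : (x == p) && (y == q) || (x == q) && (y == p) ->
  0 < i -> #|[set t in Z | c x t == i]| + (c p q == i) = cdeg c i x.
Proof.
move=> xy i0; rewrite /cdeg -(cardsID Z [set t | c x t == i]).
congr (_ + _); first by apply: eq_card => t; rewrite !inE andbC.
have xyE : c p q = c x y.
  by case/orP: xy => /andP[/eqP -> /eqP ->] //; rewrite (col_sym cc).
have ZE t : t \in ~: Z = (t == x) || (t == y).
  by case/orP: xy => /andP[/eqP -> /eqP ->]; rewrite !inE negbK // orbC.
rewrite xyE (_ : _ :\: Z = if c x y == i then [set y] else set0).
  by case: eqP => _; rewrite ?cards1 ?cards0.
apply/setP => t; rewrite in_setD -in_setC ZE inE.
have [->|tx] := eqVneq t x.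
  rewrite (col_diag cc) (_ : (0 == i) = false); last by lia.
  rewrite andbF.
  case: ifP => _; rewrite !inE //; apply/esym/negbTE.
  by case/orP: xy => /andP[/eqP -> /eqP ->]; rewrite // eq_sym.
by have [->|ty] := eqVneq t y; case: ifP; rewrite !inE ?eqxx ?(negbTE ty).
Qed.

Lemma card_setZ_p i : 0 < i -> #|[set t in Z | c p t == i]| + (c p q == i) = cdeg c i p.
Proof. by apply: (@card_setZ _ _ q); rewrite !eqxx. Qed.

Lemma card_setZ_q i : 0 < i -> #|[set t in Z | c q t == i]| + (c p q == i) = cdeg c i q.
Proof. by apply: (@card_setZ _ _ p); rewrite !eqxx orbT. Qed.

Lemma cdeg_big i x : m + 3 <= i -> cdeg c i x = 0.
Proof.
move=> im; apply: eq_card0 => y; rewrite inE; apply/negbTE.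
by have := col_lt cc x y; lia.
Qed.

Lemma cdeg_pq i : 2 < i -> cdeg c i p = cdeg c i q /\ cdeg c i p <= 1.
Proof.
move=> i2; case: (ltnP i (m + 3)) => im; last by rewrite !cdeg_big.
by rewrite !(col_perfect cc) ?i2.
Qed.

Lemma path_le1 i : 2 < i -> #|[set t in Z | c p t == i]| <= 1.
Proof. by move=> i2; have := @card_setZ_p i; have := cdeg_pq i2; lia. Qed.

Lemma path_card i : 2 < i ->
  #|[set t in Z | c p t == i]| = #|[set t in Z | c q t == i]|.
Proof.
by move=> i2; have := @card_setZ_p i; have := @card_setZ_q i; have := cdeg_pq i2; lia.
Qed.

Definition walk (S : {set V}) := reach Z (c p) (c q) S.

Lemma walk_split S t : t \in walk S -> exists2 s, s \in S & t \in walk [set s].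
Proof. exact: reach_split. Qed.

Section Starts.
Variable S : {set V}.
Hypothesis SZ : S \subset [set t in Z | c p t <= 1].

Lemma walk_sub : walk S \subset Z. Proof. exact: reach_sub SZ. Qed.

Lemma walk_starts : [set t in walk S | c p t <= 1] = S.
Proof. exact: reach_starts SZ. Qed.

Lemma walk_balanced i : 2 < i ->
  #|[set t in walk S | c p t == i]| = #|[set t in walk S | c q t == i]|.
Proof. exact: (reach_balanced path_le1 path_card SZ). Qed.

Lemma card_walk_ends : #|[set t in walk S | c q t <= 2]| = #|S|.
Proof.
exact: (card_reach_ends (col_lt cc p) (col_lt cc q) path_neq2 path_le1 path_card SZ).
Qed.

Lemma walk_mono (S' : {set V}) : S' \subset S -> walk S' \subset walk S.
Proof.
move=> /subsetP S'S; apply/subsetP => t; rewrite !inE => /existsP[s /andP[/S'S sS st]].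
by apply/existsP; exists s; rewrite sS.
Qed.
End Starts.

Lemma walk_end t : t \in Z -> c q t <= 2 ->
  exists2 s, s \in [set s in Z | c p s <= 1] & t \in walk [set s].
Proof. exact: (reach_end (col_lt cc p) (col_lt cc q) path_neq2 path_le1 path_card). Qed.

End Paths.
End Coloring.

(* M misses p in c and q in c'.  The last clause keeps the rest edges at q,
   which lets several moves be chained. *)
Record moved (V : finType) (D : V -> nat) (m : nat) (c c' : V -> V -> nat)
    (p q : V) : Prop := Moved {
  moved_col : coloring D m c';
  moved_p : cdeg c' 2 p = 1;
  moved_q : cdeg c' 2 q = 0;
  moved_deg : forall x, x != p -> x != q -> cdeg c' 2 x = cdeg c 2 x;
  moved_out : forall x y, x != p -> x != q -> y != p -> y != q -> c' x y = c x y;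
  moved_keep : forall t, c q t = 1 -> c' q t = 1
}.

(** * Moving the vertex missed by the matching *)

Section Shift.

Variables (V : finType) (D : V -> nat) (m : nat) (c : V -> V -> nat) (p q : V).
Hypothesis cc : coloring D m c.
Hypothesis pq : p != q.
Hypothesis p_missed : cdeg c 2 p = 0.
Hypothesis q_hit : cdeg c 2 q = 1.

Let Z := ~: [set p; q].
Let start_ok (S : {set V}) := S \subset [set t in Z | c p t <= 1].

(** The 1-factor colours are balanced along walks. The remaining conditions preserve the degrees,
    bring one matching edge from [q] to [p], and take no rest edge (colour 1) away from [q]. *)
Lemma moved_of_walk (S : {set V}) : start_ok S ->
  #|[set t in walk c p q S | c p t == 0]| = #|[set t in walk c p q S | c q t == 0]| ->
  #|[set t in walk c p q S | c q t == 2]| = 1 ->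
  (forall t, t \in walk c p q S -> c q t != 1) ->
  moved D m c (swap_colors c p q (walk c p q S)) p q.
Proof.
move=> SZ bal0 one2 no1; set U := walk c p q S in bal0 one2 no1 *.
have UZ : U \subset ~: [set p; q] := walk_sub SZ.
have p2 : #|[set t in U | c p t == 2]| = 0.
  apply: eq_card0 => t; rewrite inE; apply/negbTE/nandP.
  by case tU: (t \in U); [right; apply: (path_neq2 p_missed) (subsetP UZ _ tU)|left].
have cp := cdeg_swap_p c UZ 2; have cq := cdeg_swap_q 2 (col_sym cc) UZ.
split=> [|||x xp xq|x y xp xq yp yq|t qt]; first last.
- by rewrite swap_colors_q //; case: ifP => // /no1; rewrite qt.
- exact: swap_colors_out.
- by rewrite cdeg_swap_out.
- lia.
- lia.
apply: coloring_swap => //; [|lia|lia].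
move=> i /orP[/eqP -> //|i2]; exact: (walk_balanced cc pq p_missed SZ).
Qed.

Lemma walk1_end t1 t : start_ok [set t1] -> t \in walk c p q [set t1] -> c q t <= 2 ->
  forall t', t' \in walk c p q [set t1] -> c q t' <= 2 -> t' = t.
Proof.
move=> SZ tU qt t' t'U qt'.
have := card_walk_ends cc pq p_missed SZ; rewrite cards1 => /eqP/cards1P[e E].
have inE1 s : s \in walk c p q [set t1] -> c q s <= 2 -> s = e.
  by move=> sU qs; apply/set1P; rewrite -E inE sU.
by rewrite (inE1 t) // (inE1 t').
Qed.

(** The walk trades a rest edge at [p] for the matching edge at [q], with no non-edge involved. *)
Lemma shift_direct t1 t : start_ok [set t1] -> c p t1 = 1 ->
  t \in walk c p q [set t1] -> c q t = 2 -> exists c', moved D m c c' p q.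
Proof.
move=> SZ pt1 tU qt; have endE := walk1_end SZ tU; rewrite qt in endE.
exists (swap_colors c p q (walk c p q [set t1])); apply: moved_of_walk => //.
- rewrite !eq_card0 // => t'; rewrite inE; apply/negbTE/andP => -[t'U /eqP t'0].
    by move: (endE isT t' t'U); rewrite t'0 => /(_ isT) e; rewrite e qt in t'0.
  have: t' \in [set t1] by rewrite -(walk_starts SZ) inE t'U t'0.
  by rewrite inE => /eqP e; rewrite e pt1 in t'0.
- apply/eqP/cards1P; exists t; apply/setP => t'; rewrite [LHS]inE inE.
  apply/andP/eqP => [[t'U /eqP t'2]|->]; last by rewrite qt.
  by apply: endE => //; rewrite t'2.
- move=> t' t'U; apply/eqP => t'1.
  by move: (endE isT t' t'U); rewrite t'1 => /(_ isT) e; rewrite e qt in t'1.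
Qed.

(** A walk from [t1] to a non-edge of [q] would by itself change degrees. The walk ending at the
    mate [m0] of [q] helps: if it starts at a rest edge of [p], it suffices alone; otherwise it
    starts at a non-edge of [p], which compensates the one at [q]. *)
Lemma shift_matching t1 t : start_ok [set t1] -> c p t1 = 1 ->
  t \in walk c p q [set t1] -> c q t <= 2 -> c q t != 1 ->
  exists c', moved D m c c' p q.
Proof.
move=> SZ pt1 tU qt_le qt1.
have [qt2|qt2] := eqVneq (c q t) 2; first exact: (shift_direct SZ pt1 tU).
have qt0 : c q t = 0 by lia.
have [m0 qm0] : exists y, c q y = 2.
  have /card_gt0P[y] : 0 < cdeg c 2 q by rewrite q_hit.
  by rewrite inE => /eqP; exists y.
have m0Z : m0 \in Z.
  rewrite !inE; apply/norP; split; apply/eqP => e; rewrite e in qm0.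
    have : q \in [set y | c p y == 2] by rewrite inE (col_sym cc) qm0.
    by move/eqP: p_missed; rewrite cards_eq0 => /eqP ->; rewrite inE.
  by rewrite (col_diag cc) in qm0.
have [|t0 t0S m0U] := walk_end cc pq p_missed m0Z; first by rewrite qm0.
have S0 : start_ok [set t0] by rewrite /start_ok sub1set.
have [pt0|pt0] := eqVneq (c p t0) 1; first exact: (shift_direct S0 pt0 m0U).
have {}pt0 : c p t0 = 0 by move: t0S; rewrite inE; lia.
(* At [p] the starts are a non-edge [t0] and a rest edge [t1]; at [q] the ends are the matching edge
   [m0] and a non-edge [t]. *)
pose S := [set t0; t1].
have t01 : t0 != t1 by apply/eqP => e; rewrite e pt1 in pt0.
have SS : start_ok S by rewrite /start_ok subUset; apply/andP.
have tW : t \in walk c p q S by apply: (subsetP (walk_mono c p q (subsetUr _ _))) tU.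
have mW : m0 \in walk c p q S by apply: (subsetP (walk_mono c p q (subsetUl _ _))) m0U.
have mt : m0 != t by apply/eqP => e; rewrite e qt0 in qm0.
have ends : [set s in walk c p q S | c q s <= 2] = [set m0; t].
  apply/esym/eqP; rewrite eqEcard (card_walk_ends cc pq p_missed SS) !cards2 mt t01.
  rewrite leqnn andbT; apply/subsetP => s.
  case/set2P=> ->; rewrite inE.
    by rewrite mW qm0.
  by rewrite tW qt0.
have endE s : s \in walk c p q S -> c q s <= 2 -> s = m0 \/ s = t.
  move=> sU qs; have : s \in [set m0; t] by rewrite -ends inE sU.
  by rewrite !inE => /orP[/eqP ->|/eqP ->]; [left|right].
exists (swap_colors c p q (walk c p q S)); apply: moved_of_walk => //.
- rewrite (_ : [set s in _ | c p s == 0] = [set t0]).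
    rewrite (_ : [set s in _ | c q s == 0] = [set t]); first by rewrite !cards1.
    apply/setP => s; rewrite [LHS]inE inE; apply/andP/eqP => [[sU /eqP s0]|->].
      by have [||e|//] := @endE s; rewrite ?s0 //; rewrite e qm0 in s0.
    by rewrite qt0.
  apply/setP => s; rewrite [LHS]inE inE; apply/andP/eqP => [[sU /eqP s0]|->].
    have: s \in S by rewrite -(walk_starts SS) inE sU s0.
    by rewrite !inE => /orP[/eqP //|/eqP e]; rewrite e pt1 in s0.
  by rewrite pt0; split=> //; apply: (subsetP (reach_incl _ _ _ _)); rewrite !inE eqxx.
- apply/eqP/cards1P; exists m0; apply/setP => s; rewrite [LHS]inE inE.
  apply/andP/eqP => [[sU /eqP s2]|->]; last by rewrite qm0.
  by have [||//|e] := @endE s; rewrite ?s2 //; rewrite e qt0 in s2.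
- move=> s sU; apply/eqP => s1.
  by have [||e|e] := @endE s; rewrite ?s1 //; move: s1; rewrite e ?qm0 ?qt0.
Qed.

(** Otherwise all walks from rest edges at [p] end at rest edges at [q]; then [q] has at least as
    many rest edges as [p] and a matching edge besides, so [D p < D q]. *)
Lemma shift_of_degree : D q <= D p -> exists c', moved D m c c' p q.
Proof.
move=> Dqp; pose S := [set t in Z | c p t == 1].
have SS : start_ok S.
  by apply/subsetP => t /setIdP[tZ /eqP tp]; apply/setIdP; rewrite tp.
have [t tU /andP[t2 t1]] : exists2 t, t \in walk c p q S & (c q t <= 2) && (c q t != 1).
  apply/exists_inP; apply: contraT => /exists_inPn no.
  have : #|S| <= #|[set t in Z | c q t == 1]|.
    rewrite -(card_walk_ends cc pq p_missed SS); apply: subset_leq_card.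
    apply/subsetP => t /setIdP[tU t2].
    apply/setIdP; split; first exact: (subsetP (walk_sub SS)).
    by have := no _ tU; rewrite t2 /= negbK.
  have := card_setZ_p cc pq p_missed (i := 1) isT; have := card_setZ_q cc pq p_missed (i := 1) isT.
  have := coloring_degree p cc; have := coloring_degree q cc.
  by rewrite -/Z -/S; lia.
have [s /setIdP[sZ /eqP sp] st] := walk_split tU.
apply: (@shift_matching s t) => //.
by rewrite /start_ok sub1set; apply/setIdP; rewrite sp.
Qed.

End Shift.

Lemma sum_bool_card (T : finType) (U : {set T}) (P : pred T) :
  \sum_(t in U) P t = #|[set t in U | P t]|.
Proof.
rewrite -sum1_card big_mkcond [RHS]big_mkcond; apply: eq_bigr => t _.
by rewrite inE; case: (t \in U); case: (P t).
Qed.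

(** On a colouring this is twice the number of edges of the matching. *)
Definition matched (V : finType) (c : V -> V -> nat) : nat := \sum_x cdeg c 2 x.

(** * Adding a rest edge to the matching *)

Section Recolor.

Variables (V : finType) (D : V -> nat) (m : nat) (c : V -> V -> nat).
Hypothesis cc : coloring D m c.

Definition match_edge (p q x y : V) : nat :=
  if (x == p) && (y == q) || (x == q) && (y == p) then 2 else c x y.

Lemma match_edge_sym p q x y : match_edge p q x y = match_edge p q y x.
Proof. by rewrite /match_edge (col_sym cc) orbC andbC [in X in _ || X]andbC. Qed.

Lemma match_edgeC p q x y : match_edge p q x y = match_edge q p x y.
Proof. by rewrite /match_edge orbC. Qed.

Lemma cdeg_match_edge_end p q i : p != q -> c p q = 1 ->
  cdeg (match_edge p q) i p + (i == 1) = cdeg c i p + (i == 2).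
Proof.
move=> pq pq1; rewrite /cdeg (cardsD1 q) [in RHS](cardsD1 q) !inE.
rewrite /match_edge !eqxx /= pq1 (eq_sym 2) (eq_sym 1).
rewrite (_ : _ :\ q = [set y | c p y == i] :\ q); first lia.
apply/setP => y; rewrite !inE (negbTE pq) /= orbF.
by case: eqVneq.
Qed.

Lemma cdeg_match_edge_out p q i x : x != p -> x != q ->
  cdeg (match_edge p q) i x = cdeg c i x.
Proof.
move=> /negbTE xp /negbTE xq.
by apply: eq_card => y; rewrite !inE /match_edge xp xq.
Qed.

Lemma cdeg_match_edge p q i x : p != q -> c p q = 1 ->
  cdeg (match_edge p q) i x + ((x == p) || (x == q)) * (i == 1) =
  cdeg c i x + ((x == p) || (x == q)) * (i == 2).
Proof.
move=> pq pq1; have [->|xp] := eqVneq x p.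
  by rewrite !mul1n cdeg_match_edge_end.
have [->|xq] := eqVneq x q; last by rewrite cdeg_match_edge_out.
rewrite !mul1n -(@cdeg_match_edge_end q p) 1?eq_sym //; last by rewrite (col_sym cc).
by congr (_ + _); apply: eq_card => y; rewrite !inE match_edgeC.
Qed.

Lemma match_edge_coloring p q : p != q -> c p q = 1 ->
  cdeg c 2 p = 0 -> cdeg c 2 q = 0 -> coloring D m (match_edge p q).
Proof.
move=> pq pq1 p0 q0; split=> [x y|x|x y|x|x i i2|x].
- exact: match_edge_sym.
- rewrite /match_edge (col_diag cc).
  by case: ifP => //; case: eqVneq => [->|_]; rewrite ?(negbTE pq) //= andbF.
- by rewrite /match_edge; case: ifP => _; [lia|apply: (col_lt cc)].
- by have := cdeg_match_edge 0 x pq pq1; have := col_deg0 cc x; rewrite !muln0; lia.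
- have := cdeg_match_edge i x pq pq1; rewrite (col_perfect cc) //.
  have -> : (i == 1) = false by lia.
  have -> : (i == 2) = false by lia.
  by rewrite !muln0; lia.
- have := cdeg_match_edge 2 x pq pq1; have := col_matching cc x.
  have [->|_] := eqVneq x p; first by rewrite p0 /=; lia.
  by have [->|_] := eqVneq x q; rewrite ?q0 /=; lia.
Qed.

Lemma match_edge_matched p q : p != q -> c p q = 1 ->
  matched c < matched (match_edge p q).
Proof.
move=> pq pq1; rewrite /matched (bigD1 p) //= [in X in _ < X](bigD1 p) //=.
rewrite -addSn leq_add //.
  by have := cdeg_match_edge 2 p pq pq1; rewrite eqxx /=; lia.
apply: leq_sum => x _; have := cdeg_match_edge 2 x pq pq1; lia.
Qed.

End Recolor.

Lemma moved_matched (V : finType) (D : V -> nat) m c c' (p q : V) :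
  p != q -> cdeg c 2 p = 0 -> cdeg c 2 q = 1 -> moved D m c c' p q ->
  matched c' = matched c.
Proof.
move=> pq p0 q1 mv; rewrite /matched (bigD1 p) // (bigD1 q) 1?eq_sym //=.
rewrite [RHS](bigD1 p) // [in RHS](bigD1 q) 1?eq_sym //=.
rewrite p0 q1 (moved_p mv) (moved_q mv); congr (_ + _).
by congr (_ + _); apply: eq_bigr => x /andP[xp xq]; apply: (moved_deg mv).
Qed.

(** * Optimal configurations *)

Section Optimum.

Variables (V : finType) (D : V -> nat) (m : nat) (c0 : V -> V -> nat) (u v : V).

Record missed_pair (c : V -> V -> nat) (a b : V) : Prop := MissedPair {
  mp_col : coloring D m c;
  mp_matched : matched c = matched c0;
  mp_neq : a != b;
  mp_l : cdeg c 2 a = 0;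
  mp_r : cdeg c 2 b = 0
}.

Hypothesis uv0 : missed_pair c0 u v.
Hypothesis Dvu : D v <= D u.
Hypothesis max_matched : forall c, coloring D m c -> matched c <= matched c0.
Hypothesis max_pair : forall c a b, missed_pair c a b -> D a + D b <= D u + D v.

Let W := [set w | (w != u) && (D w <= D v)].
Let A := [set z | (z != u) && (D v < D z)].

Lemma v_in_W : v \in W.
Proof. by rewrite !inE leqnn andbT eq_sym (mp_neq uv0). Qed.

Lemma missed_pairC c a b : missed_pair c a b -> missed_pair c b a.
Proof. by case=> *; split; rewrite // eq_sym. Qed.

Lemma missed_not_rest c a b : missed_pair c a b -> c a b != 1.
Proof.
move=> ab; apply/eqP => ab1.
have := max_matched (match_edge_coloring (mp_col ab) (mp_neq ab) ab1 (mp_l ab) (mp_r ab)).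
rewrite leqNgt -(mp_matched ab) => /negP; apply.
exact: (match_edge_matched (mp_col ab) (mp_neq ab) ab1).
Qed.

Lemma missed_pair_moved c c' a p q : missed_pair c a p -> q != p -> q != a ->
  cdeg c 2 q = 1 -> moved D m c c' p q -> missed_pair c' a q.
Proof.
move=> ap qp qa q1 mv; split; first exact: (moved_col mv).
- rewrite (moved_matched _ (mp_r ap) q1 mv) 1?eq_sym //; exact: (mp_matched ap).
- by rewrite eq_sym.
- rewrite (moved_deg mv); [exact: (mp_l ap)|exact: (mp_neq ap)|by rewrite eq_sym].
- exact: (moved_q mv).
Qed.

(** If [q] is already missed, [c] itself serves; otherwise the degree condition allows a move from
    [p] to [q]. *)
Lemma move_missed c a p q : missed_pair c a p -> q != a -> D q <= D p ->
  exists c', [/\ missed_pair c' a q, forall t, c q t = 1 -> c' q t = 1 &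
    forall x y, x != p -> x != q -> y != p -> y != q -> c' x y = c x y].
Proof.
move=> ap qa Dqp.
have [q0|q1] : cdeg c 2 q = 0 \/ cdeg c 2 q = 1.
  by have := col_matching (mp_col ap) q; lia.
  by exists c; split=> //; case: ap => *; split; rewrite // eq_sym.
have qp : q != p by apply/eqP => e; move: q1; rewrite e (mp_r ap).
have pq : p != q by rewrite eq_sym.
have [c' mv] := shift_of_degree (mp_col ap) pq (mp_r ap) q1 Dqp.
exists c'; split; last exact: (moved_out mv).
  exact: (missed_pair_moved ap qp qa q1 mv).
exact: (moved_keep mv).
Qed.

(** Moving the missed vertex [v] to [a] and then, unless [b] is [u], [u] to [b] would give two
    missed vertices joined by a rest edge. The colouring is arbitrary because this is also needed
    after an exchange. *)
Lemma low_independent c a b : missed_pair c u v -> a \in W -> b \in u |: W ->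
  a != b -> c a b != 1.
Proof.
move=> uv; rewrite !inE => /andP[au Da] Wb ab; apply/eqP => ab1.
have [c1 [ua keep1 _]] := move_missed uv au Da.
have [bu|bu] := eqVneq b u.
  have := missed_not_rest (missed_pairC ua); rewrite -bu keep1 //; exact.
have Db : D b <= D u by move: Wb; rewrite (negbTE bu) /=; lia.
have ba : b != a by rewrite eq_sym.
have [c2 [ab2 keep2 _]] := move_missed (missed_pairC ua) ba Db.
have := missed_not_rest (missed_pairC ab2).
by rewrite keep2 // (col_sym (mp_col ua)) keep1.
Qed.

Lemma classify x : [|| x == u, x \in W | x \in A].
Proof. by rewrite !inE; case: eqP => //= _; case: leqP. Qed.

Lemma W_not_A x : x \in W -> x \notin A.
Proof. by rewrite !inE => /andP[-> D1] /=; rewrite -leqNgt. Qed.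

Lemma rest_of_low_high w x : w \in W -> c0 w x = 1 -> x \in A.
Proof.
move=> wW wx; have := classify x; case/or3P=> [xu|xW|//];
  have [wx'|wx'] := eqVneq w x; try by move: wx; rewrite wx' (col_diag (mp_col uv0)).
  by have := low_independent uv0 wW (b := x); rewrite !inE xu wx wx' => /(_ isT isT).
by have := low_independent uv0 wW (b := x); rewrite in_setU xW orbT wx wx' => /(_ isT isT).
Qed.

Lemma A_hit c w z : missed_pair c u w -> z \in A -> w \in W -> cdeg c 2 z = 1.
Proof.
rewrite inE => uw /andP[zu Dz] wW; have := col_matching (mp_col uw) z.
case E: (cdeg c 2 z) => [|[|//]] // _.
have uz : missed_pair c u z by case: uw => *; split; rewrite // eq_sym.
by have := max_pair uz; lia.
Qed.

(** Let [w] be missed instead of [v]. Then [x] alone is a walk from the rest edge [w x] to the pair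
    [z x]. If that were a non-edge or a matching edge, [z] could be missed instead of [w], although
    [D z] exceeds [D v]. *)
Lemma rest_low_complete w x z : w \in W -> c0 w x = 1 -> z \in A -> z != x ->
  (c0 x z != 0) && (c0 x z != 2).
Proof.
move=> wW wx zA zx; have xA := rest_of_low_high wW wx.
have vW := v_in_W.
have ne a b : a \in A -> b \in W -> a != b.
  by move=> aA bW; apply: contraTneq aA => ->; apply: W_not_A.
move: (wW); rewrite inE => /andP[wu Dw].
have [c1 [uw keep out]] := move_missed uv0 wu Dw.
have xz : c0 x z = c1 x z by rewrite out // ne.
have zw := ne _ _ zA wW; have zu : z != u by move: zA; rewrite inE => /andP[].
have wz : w != z by rewrite eq_sym.
have z1 := A_hit uw zA wW.
rewrite -negb_or xz; apply/negP => bad.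
have xZ : x \in ~: [set w; z] by rewrite !inE negb_or ne // eq_sym.
have x1 : c1 w x = 1 by rewrite keep.
have xwalk : x \in walk c1 w z [set x] by apply: (subsetP (reach_incl _ _ _ _)); rewrite inE.
have [|||||c2 mv] := shift_matching (mp_col uw) wz (mp_r uw) z1 (t1 := x) (t := x).
- by rewrite sub1set; apply/setIdP; rewrite x1.
- by [].
- by [].
- by rewrite (col_sym (mp_col uw)); lia.
- by rewrite (col_sym (mp_col uw)); lia.
have := max_pair (missed_pair_moved uw zw zu z1 mv).
by move: zA; rewrite inE; lia.
Qed.

(** The mate of [x] is not [u], which is missed, and not in [A], by [rest_low_complete]. *)
Lemma rest_low_mate w x : w \in W -> c0 w x = 1 ->
  exists2 y, y \in W & c0 x y = 2.
Proof.
move=> wW wx; have xA := rest_of_low_high wW wx.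
have vW := v_in_W.
have /card_gt0P[y] : 0 < cdeg c0 2 x by rewrite (A_hit uv0 xA vW).
rewrite inE => /eqP xy; exists y => //.
have := classify y; case/or3P=> [/eqP yu|//|yA].
  have xZ : x \in ~: [set u; v].
    rewrite !inE negb_or; move: (xA); rewrite inE => /andP[-> _] /=.
    by apply: contraTneq xA => ->; apply: W_not_A.
  by have := path_neq2 (mp_l uv0) xZ; rewrite (col_sym (mp_col uv0)) -yu xy.
have yx : y != x.
  by apply/eqP => e; move: xy; rewrite e (col_diag (mp_col uv0)).
by have := rest_low_complete wW wx yA yx; rewrite xy.
Qed.

(** An end off the rest edges of [x] would allow [x] to be missed instead of [u] and then [w]
    instead of [v], keeping the rest edge [w x]. An end in [W] would, after the exchange along the
    walk, be joined to [u] by a rest edge, against [low_independent]. *)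
Lemma rest_low_walk w x t1 t : w \in W -> c0 w x = 1 ->
  t1 \in ~: [set u; x] -> c0 u t1 = 1 -> t \in walk c0 u x [set t1] ->
  c0 x t <= 2 -> (c0 x t == 1) && (t \in A).
Proof.
move=> wW wx t1Z ut1 tU xt2; have xA := rest_of_low_high wW wx.
have cc := mp_col uv0.
have vW := v_in_W.
have := xA; rewrite inE => /andP[xu Dx]; have := wW; rewrite inE => /andP[wu Dw].
have ux : u != x by rewrite eq_sym.
have SZ : [set t1] \subset [set s in ~: [set u; x] | c0 u s <= 1].
  by rewrite sub1set; apply/setIdP; rewrite ut1.
have ne b : b \in W -> x != b by move=> bW; apply: contraTneq xA => ->; apply: W_not_A.
have end1 s : s \in walk c0 u x [set t1] -> c0 x s <= 2 -> c0 x s == 1.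
  move=> sU xs2; apply: contraT => xs1.
  have [c1 mv] := shift_matching cc ux (mp_l uv0) (A_hit uv0 xA vW) SZ ut1 sU xs2 xs1.
  have vx := missed_pair_moved (missed_pairC uv0) xu (ne _ vW) (A_hit uv0 xA vW) mv.
  have wx' : w != x by rewrite eq_sym ne.
  have [c2 [xw keep _]] := move_missed (missed_pairC vx) wx' Dw.
  have := missed_not_rest (missed_pairC xw).
  by rewrite keep // (col_sym (moved_col mv)) (moved_keep mv) // (col_sym cc).
rewrite (end1 _ tU xt2) /=; set U := walk c0 u x [set t1] in tU end1 *.
have UZ : U \subset ~: [set u; x] := walk_sub SZ.
(* Neither side has colour 0 or 2 along the walk, so the exchange affects neither the degrees nor
   which vertices the matching misses. *)
have no i : i != 1 -> i <= 2 -> #|[set s in U | c0 x s == i]| = 0.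
  move=> i1 i2; apply: eq_card0 => s; rewrite inE; apply/negbTE/andP => -[sU /eqP xs].
  by have := end1 _ sU; rewrite xs i2 (negbTE i1) => /(_ isT).
have no' i : i != 1 -> i <= 2 -> #|[set s in U | c0 u s == i]| = 0.
  move=> i1 i2; apply: eq_card0 => s; rewrite inE; apply/negbTE/andP => -[sU /eqP us].
  have [i0|i2'] : i <= 1 \/ i = 2 by lia.
    have: s \in [set t1] by rewrite -(walk_starts SZ) inE sU us.
    by rewrite inE => /eqP e; move: us; rewrite e ut1 => e1; rewrite -e1 in i1.
  by have := path_neq2 (mp_l uv0) (subsetP UZ _ sU); rewrite us i2'.
have cu := cdeg_swap_p c0 UZ 2; have cx := cdeg_swap_q 2 (col_sym cc) UZ.
rewrite !(no 2) // !(no' 2) // !addn0 in cu cx.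
have cc' : coloring D m (swap_colors c0 u x U).
  apply: coloring_swap => //; rewrite ?cu ?cx ?(col_matching cc) //.
  move=> i /orP[/eqP ->|i2]; first by rewrite no ?no'.
  exact: (walk_balanced cc ux (mp_l uv0) SZ).
have deg2 y : cdeg (swap_colors c0 u x U) 2 y = cdeg c0 2 y.
  have [->//|yu] := eqVneq y u; have [->//|yx] := eqVneq y x.
  by rewrite cdeg_swap_out.
have uv : missed_pair (swap_colors c0 u x U) u v.
  split=> //; rewrite ?deg2; [|exact: (mp_neq uv0)|exact: (mp_l uv0)|exact: (mp_r uv0)].
  by apply: eq_bigr => y _.
have tu : t != u by have /andP[] := swap_U_neq UZ tU.
have := classify t; case/or3P => [|tW|//]; first by rewrite (negbTE tu).
have := low_independent uv tW (setU11 u W) tu.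
rewrite swap_colors_sym ?swap_colors_p ?tU //; last exact: (col_sym cc).
by rewrite (end1 _ tU xt2).
Qed.

Let A0 := [set x in A | [exists w in W, c0 w x == 1]].
Let low x := #|[set w in W | c0 x w == 1]|.

Lemma card_classes (P : pred V) : #|[set x | P x]| =
  P u + #|[set x in W | P x]| + #|[set x in A | P x]|.
Proof.
rewrite -(cardsID (u |: W) [set x | P x]); congr (_ + _).
  rewrite (cardsD1 u) !inE eqxx andbT; congr (_ + _); apply: eq_card => x.
  by rewrite !inE; case: eqVneq => //= _; rewrite andbC.
apply: eq_card => x; rewrite !inE; case: eqVneq => //= _; rewrite -ltnNge.
by rewrite andbC.
Qed.

Lemma A0P x : x \in A0 -> exists2 w, w \in W & c0 w x = 1.
Proof. by rewrite inE => /andP[_ /exists_inP[w wW /eqP wx]]; exists w. Qed.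

(** Walks lead from the rest edges at [u] to as many rest edges from [x] into [A]. Besides these,
    [x] has [low x] rest edges into [W] and its matching edge, whence the 1. *)
Lemma A0_degree_u x : x \in A0 -> D u + 1 + low x <= D x.
Proof.
move=> xA0; have [w wW wx] := A0P xA0; have cc := mp_col uv0.
have vW := v_in_W.
have xA : x \in A := rest_of_low_high wW wx.
have ux : u != x by move: (xA); rewrite inE => /andP[]; rewrite eq_sym.
rewrite (coloring_degree u cc) (coloring_degree x cc) (mp_l uv0) (A_hit uv0 xA vW).
have := card_setZ_p cc ux (mp_l uv0) (i := 1) isT.
rewrite [cdeg c0 1 x]card_classes (col_sym cc x u).
set S := [set t in _ | _].
suff : #|S| <= #|[set t in A | c0 x t == 1]| by rewrite /low; lia.
have SZ : S \subset [set t in ~: [set u; x] | c0 u t <= 1].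
  by apply/subsetP => t /setIdP[tZ /eqP t1]; apply/setIdP; rewrite t1.
rewrite -(card_walk_ends cc ux (mp_l uv0) SZ); apply: subset_leq_card.
apply/subsetP => t /setIdP[/walk_split[s /setIdP[sZ /eqP us] tW] t2].
by have /andP[t1 tA] := rest_low_walk wW wx sZ us tW t2; apply/setIdP.
Qed.

(** Vertices not adjacent to [x] are counted by class: possibly [u]; in [W], neither the [low x]
    rest neighbours nor the mate of [x]; in [A], at most [x] itself. *)
Lemma A0_degree_card x : x \in A0 -> #|A| + low x <= D x.
Proof.
move=> xA0; have [w wW wx] := A0P xA0; have cc := mp_col uv0.
have xA : x \in A := rest_of_low_high wW wx.
have [y yW xy] := rest_low_mate wW wx.
have := col_deg0 cc x; rewrite [cdeg c0 0 x]card_classes -cardsT.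
rewrite (_ : [set: V] = [set t | xpredT t]); last by apply/setP => t; rewrite !inE.
rewrite (card_classes xpredT).
have WE : #|[set t in W | c0 x t == 0]| + low x < #|[set t in W | xpredT t]|.
  rewrite -(cardsID [set t in W | c0 x t == 0] [set t in W | xpredT t]) -addnS leq_add //.
    by apply: subset_leq_card; apply/subsetP => t tS; rewrite inE tS; move: tS; rewrite !inE => /andP[-> _].
  rewrite (cardsD1 y) (_ : y \in _); last first.
    by rewrite in_setD !(inE, xy) andbF /= andbT; move: yW; rewrite inE.
  rewrite add1n ltnS; apply: subset_leq_card; apply/subsetP => t /setIdP[tW /eqP t1].
  rewrite !in_setD in_set1; apply/and3P; split.
  - by apply/eqP => e; move: t1; rewrite e xy.
  - by apply/negP => /setIdP[_]; rewrite t1.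
  - exact/setIdP.
have AE : #|[set t in A | c0 x t == 0]| <= 1.
  rewrite -(cards1 x); apply: subset_leq_card; apply/subsetP => t /setIdP[tA t0].
  rewrite inE; apply/negPn/negP => tx.
  by have /andP[] := rest_low_complete wW wx tA tx; rewrite t0.
have -> : #|[set t in A | xpredT t]| = #|A|.
  by apply: eq_card => t; rewrite [LHS]inE andbT.
rewrite /low in WE *; case: (c0 x u == 0) => /=; lia.
Qed.

(** All rest edges at [W] end in [A0]; they are counted from both sides. *)
Lemma sum_low : \sum_(w in W) cdeg c0 1 w = \sum_(x in A0) low x.
Proof.
have cc := mp_col uv0.
under eq_bigr => w wW.
  rewrite (_ : cdeg c0 1 w = \sum_(x in A0) (c0 w x == 1)); last first.
    rewrite sum_bool_card; apply: eq_card => x; rewrite [LHS]inE.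
    apply/idP/setIdP => [wx|[]//]; split=> //.
    rewrite inE (rest_of_low_high wW (eqP wx)) /=.
    by apply/exists_inP; exists w.
over.
rewrite exchange_big; apply: eq_bigr => x _ /=; rewrite sum_bool_card.
by apply: eq_card => w; rewrite [LHS]inE [RHS]inE (col_sym cc).
Qed.

(** Mates inject [A0] into [W] and avoid the missed vertex [v]; the injection is expressed by double
    counting matching edges. *)
Lemma card_A0_lt_W : #|A0| < #|W|.
Proof.
have cc := mp_col uv0.
have vW := v_in_W.
rewrite (cardsD1 v W) vW add1n ltnS -!sum1_card.
apply: (@leq_trans (\sum_(x in A0) \sum_(y in W :\ v) (c0 x y == 2))).
  apply: leq_sum => x xA0; have [w wW wx] := A0P xA0.
  have [y yW xy] := rest_low_mate wW wx.
  have yv : y != v.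
    apply/eqP => e; have : x \in [set y | c0 v y == 2].
      by rewrite inE (col_sym cc) -e xy.
    by move/eqP: (mp_r uv0); rewrite cards_eq0 => /eqP ->; rewrite inE.
  by rewrite (bigD1 y) /= ?xy // !inE yv; move: yW; rewrite inE.
rewrite exchange_big; apply: leq_sum => y _ /=.
apply: leq_trans (col_matching cc y).
rewrite sum_bool_card; apply: subset_leq_card.
by apply/subsetP => x /setIdP[_]; rewrite inE (col_sym cc).
Qed.

Variables (dmin dmax : nat).
Hypothesis D_ge : forall x, dmin <= D x.
Hypothesis D_le : forall x, D x <= dmax.
Hypothesis m_lt : m < dmin.

(** Each vertex of [W] has at least [dmin - m.+1] rest edges, and [v], being missed, one more. As
    [W] is larger than [A0], the values [low x] exceed [dmin - m.+1] on average, whereas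
    [dmax <= b + (dmin - m.+1)] would bound each of them by it. *)
Lemma A0_degree_bound b : (forall x, x \in A0 -> b + low x <= D x) ->
  b + (dmin - m.+1) < dmax.
Proof.
move=> bD; set e := dmin - m.+1; rewrite ltnNge; apply/negP => dmax_le.
have cc := mp_col uv0.
have vW := v_in_W.
have up : #|A0| * b + \sum_(x in A0) low x <= #|A0| * (b + e).
  rewrite -!sum_nat_const -big_split; apply: leq_sum => x xA0.
  by apply: leq_trans (bD x xA0) (leq_trans (D_le x) dmax_le).
have : e.+1 + #|A0| * e <= \sum_(w in W) cdeg c0 1 w.
  rewrite (bigD1 v) //= leq_add //.
    by have := coloring_degree v cc; have := D_ge v; rewrite (mp_r uv0) /e; lia.
  apply: (@leq_trans (\sum_(w in W | w != v) e)); last first.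
    apply: leq_sum => w _; have := coloring_degree w cc; have := D_ge w.
    by have := col_matching cc w; rewrite /e; lia.
  rewrite sum_nat_cond_const leq_mul2r; apply/orP; right.
  have := card_A0_lt_W; rewrite (cardsD1 v W) vW add1n ltnS => /leq_trans; apply.
  by rewrite subset_leq_card //; apply/subsetP => w; rewrite !inE andbC.
rewrite sum_low; lia.
Qed.

Lemma missed_pair_absurd (l : nat) : dmax - dmin + m.+1 <= l ->
  l <= #|[set x | l <= (D x).+1]| -> False.
Proof.
move=> dl; rewrite leqNgt => /negP; apply.
(* With [b] equal to [D u + 1] and to [#|A|], both numbers come out below [l]. *)
have := A0_degree_bound A0_degree_u; have := A0_degree_bound A0_degree_card.
move=> cardA Du; apply: (@leq_ltn_trans #|A|); last by lia.
apply: subset_leq_card; apply/subsetP => x; rewrite [in X in X -> _]inE => lx.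
have := classify x; case/or3P=> // [/eqP xu|]; first by rewrite xu in lx; lia.
by rewrite inE => /andP[_ Dx]; lia.
Qed.
End Optimum.

(** * Induction on the number of 1-factors *)

Section Induction.

Variables (V : finType) (D : V -> nat) (dmin dmax l : nat).
Hypothesis V_even : ~~ odd #|V|.
Hypothesis D_ge : forall x, dmin <= D x.
Hypothesis D_le : forall x, D x <= dmax.
Hypothesis l_card : l <= #|[set x | l <= (D x).+1]|.

Lemma card_missed m c : coloring D m c ->
  matched c + #|[set x | cdeg c 2 x == 0]| = #|V|.
Proof.
move=> cc; rewrite /matched -sum1dep_card -[RHS]cardsT -sum1dep_card.
rewrite [X in _ + X]big_mkcond -big_split; apply: eq_big => x; rewrite ?inE // => _.
by have := col_matching cc x; case: (cdeg c 2 x) => [|[|]].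
Qed.

Lemma matched_even m c : coloring D m c -> ~~ odd (matched c).
Proof.
move=> cc; apply: (even_sum_degrees (r := fun x y => c x y == 2)) => [x y|x].
  by rewrite (col_sym cc).
by rewrite (col_diag cc).
Qed.

Lemma perfect_matching m : m < dmin -> dmax - dmin + m.+1 <= l ->
  (exists c, coloring D m c) ->
  exists2 c, coloring D m c & forall x, cdeg c 2 x = 1.
Proof.
move=> m_lt l_ge [c1 cc1].
have [||_ [c [cc ->]] max_c] := @exists_max_nat
    (fun n => exists c, coloring D m c /\ n = matched c) #|V|.
- by exists (matched c1), c1.
- by move=> _ [c [cc ->]]; rewrite -(card_missed cc) leq_addr.
exists c => // x; apply/eqP/negPn/negP => x1.
have x0 : x \in [set x | cdeg c 2 x == 0].
  by rewrite inE; have := col_matching cc x; lia.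
(* Both [#|V|] and the number of matched vertices are even, so a single vertex cannot be missed. *)
have [y y0 xy] : exists2 y, y \in [set x | cdeg c 2 x == 0] & x != y.
  have := card_missed cc; rewrite (cardsD1 x) x0 => cardE.
  have /card_gt0P[y] : 0 < #|[set x | cdeg c 2 x == 0] :\ x|.
    rewrite lt0n; apply/eqP => e0; move: V_even; rewrite -cardE e0 addn1 /=.
    by rewrite (negbTE (matched_even cc)).
  by rewrite in_setD1 => /andP[yx y0]; exists y; rewrite // eq_sym.
have [||_ [c0 [a [b [ab ->]]]] max_ab] := @exists_max_nat
    (fun n => exists c' a b, missed_pair D m c c' a b /\ n = D a + D b) (dmax + dmax).
- exists (D x + D y), c, x, y; split=> //.
  by rewrite !inE in x0 y0; split=> //; apply/eqP.
- by move=> _ [c' [a [b [_ ->]]]]; rewrite leq_add.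
wlog ba : a b ab max_ab / D b <= D a.
  move=> gen; case: (leqP (D b) (D a)) => [|/ltnW] le_ab; first exact: (gen a b).
  by apply: (gen b a) => //; [exact: missed_pairC|rewrite addnC].
have m0 := mp_matched ab.
have mp c' a' b' : missed_pair D m c0 c' a' b' <-> missed_pair D m c c' a' b'.
  by split=> -[]; split; rewrite // ?m0 // -m0.
have ab0 : missed_pair D m c0 c0 a b by apply/mp.
apply: (missed_pair_absurd ab0 ba _ _ D_ge D_le m_lt l_ge l_card).
  by move=> c' cc'; rewrite m0; apply: max_c; exists c'.
by move=> c' a' b' /mp ab'; apply: max_ab; exists c', a', b'.
Qed.

(** [m + 3] is the new top colour when there are [m.+1] 1-factors; colour 2 becomes free for the
    next matching. *)
Definition shelve_matching (m : nat) (c : V -> V -> nat) (x y : V) : nat :=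
  if c x y == 2 then m + 3 else c x y.

Lemma shelve_matching_coloring m c : coloring D m c -> (forall x, cdeg c 2 x = 1) ->
  coloring D m.+1 (shelve_matching m c).
Proof.
move=> cc c2.
have other i x : i != 2 -> i != m + 3 -> cdeg (shelve_matching m c) i x = cdeg c i x.
  move=> i2 im; apply: eq_card => y; rewrite !inE /shelve_matching.
  by case: ifP => // /eqP ->; lia.
split=> [x y|x|x y|x|x i i2|x].
- by rewrite /shelve_matching (col_sym cc).
- by rewrite /shelve_matching (col_diag cc).
- by rewrite /shelve_matching; have := col_lt cc x y; case: ifP; lia.
- by rewrite other ?(col_deg0 cc) //; lia.
- have [->|im] := eqVneq i (m + 3); last first.
    by rewrite other ?(col_perfect cc) //; lia.
  apply: etrans (c2 x); apply: eq_card => y; rewrite !inE /shelve_matching.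
  by have := col_lt cc x y; case: ifP => [/eqP ->|]; lia.
- rewrite /cdeg eq_card0 // => y; rewrite !inE /shelve_matching.
  by case: ifP => [_|->]; first lia.
Qed.

Lemma coloring_exists k : k <= dmin -> dmax - dmin + k <= l ->
  (exists c, coloring D 0 c) -> exists c, coloring D k c.
Proof.
elim: k => // k IH k_lt l_ge c0.
have [|c cc c2] := perfect_matching k_lt l_ge; first by apply: IH => //; lia.
by exists (shelve_matching k c); apply: shelve_matching_coloring.
Qed.

End Induction.

(** * From graphs to colourings and back *)

Lemma graph_coloring (V : finType) (G : sgraph V) :
  coloring (degree G) 0 (fun x y => G x y : nat).
Proof.
have G_le (x y : V) : (G x y : nat) <= 1 by case: (G x y).
split=> [x y|x|x y|x|x i|x].
- by rewrite adj_sym.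
- by rewrite adj_irrefl.
- by have := G_le x y; lia.
- rewrite -(cardsC [set y | G x y]) addnC; congr (_ + _); apply: eq_card => y.
  by rewrite !inE; case: (G x y).
- lia.
- by rewrite /cdeg eq_card0 // => y; rewrite !inE; case: (G x y).
Qed.

Section OneFactors.

Variables (V : finType) (D : V -> nat) (k : nat) (c : V -> V -> nat).
Hypothesis cc : coloring D k c.

(** The diagonal has colour 0, so [P0] excludes loops. *)
Let graph_of (P : pred nat) (P0 : P 0 = false) : sgraph V.
Proof.
refine (@SGraph V (fun x y => P (c x y)) _ _) => [x y|x].
  by rewrite (col_sym cc).
by rewrite (col_diag cc).
Defined.

Lemma coloring_one_factors :
  exists G : sgraph V, degree G =1 D /\ has_disjoint_one_factors k G.
Proof.
exists (@graph_of (fun i => i != 0) erefl); split=> [x|].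
  have := col_deg0 cc x; rewrite -(cardsC [set y | c x y == 0]).
  move/addnI => ->; apply: eq_card => y; by rewrite !inE.
exists (fun i : 'I_k => @graph_of (fun j => j == i + 3) (ltac:(lia))); split=> [i|i j ij x y].
  split=> [x y /eqP xy|x] /=; first by rewrite xy; lia.
  by have := @col_perfect _ _ _ _ cc x (i + 3); apply; have := ltn_ord i; lia.
apply/negP => /= /andP[/eqP xi /eqP xj]; case/eqP: ij; apply: val_inj => /=; lia.
Qed.

End OneFactors.

(** * Non-increasing sequences and the final assembly *)

Lemma nth_sorted_geq (d : seq nat) i j : sorted geq d -> i <= j < size d ->
  nth 0 d j <= nth 0 d i.
Proof.
have geq_trans : transitive geq by move=> a b e; rewrite /geq /=; lia.
move=> d_sorted /andP[ij j_lt].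
apply: (sorted_leq_nth geq_trans leqnn 0 d_sorted) => //; rewrite inE //.
exact: leq_ltn_trans ij j_lt.
Qed.

Lemma entry_bounds (d : seq nat) x : sorted geq d -> x \in d ->
  entry d (size d) <= x <= entry d 1.
Proof.
move=> d_sorted /(nthP 0)[i i_lt <-].
have {}i_lt : i < @size nat d := i_lt.
by apply/andP; split; apply: nth_sorted_geq => //; lia.
Qed.

Lemma count_ge_entry (d : seq nat) (j b : nat) : sorted geq d -> 0 < j <= size d ->
  b <= entry d j -> j <= count (leq b) d.
Proof.
move=> d_sorted /andP[j0 j_le] bj.
have : all (leq b) (take j d).
  apply/(all_nthP 0) => i; rewrite size_takel // => ij; rewrite nth_take //.
  by apply: leq_trans bj _; apply: nth_sorted_geq => //; lia.
rewrite all_count size_takel // => /eqP countE.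
by rewrite -{1}(cat_take_drop j d) count_cat countE leq_addr.
Qed.

Theorem theorem1p5 (n : nat) (d : n.-tuple nat) (k : nat)
  (n_even : ~~ odd n)
  (d_nonincreasing : sorted geq d)
  (d_positive : all (fun m => 0 < m) d)
  (d_graphic : graphic d)
  (k_pos : 0 < k)
  (k_le_dn : k <= entry d n)
  (d_bound : entry d (entry d 1 - entry d n + k)
             >= entry d 1 - entry d n + k - 1) :
  exists (V : finType) (G : sgraph V),
    realization G d /\ has_disjoint_one_factors k G.
Proof.
have [V [G Gd]] := d_graphic.
have cardV : #|V| = n.
  by have := perm_size Gd; rewrite size_map -cardE => ->; rewrite size_tuple.
have deg_in x : degree G x \in (d : seq nat).
  by rewrite -(perm_mem Gd); apply/mapP; exists x; rewrite // mem_enum.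
have bounds x := entry_bounds d_nonincreasing (deg_in x).
rewrite size_tuple in bounds.
set l := entry d 1 - entry d n + k in d_bound.
(* Past the end [entry] is the default 0, while [l - 1] would be positive there; for [n = 0] the
   default contradicts [0 < k <= entry d n]. *)
have l_size : 0 < l <= size d.
  have n0 : 0 < n.
    case: n d k_le_dn {d_nonincreasing d_positive d_graphic Gd deg_in bounds l d_bound n_even cardV} => // d.
    by rewrite tuple0 /entry /=; lia.
  rewrite size_tuple /l; case: (leqP l n) => [|n_lt]; first lia.
  by move: d_bound; rewrite [X in _ <= X]/entry nth_default ?size_tuple /l; lia.
have l_card : l <= #|[set x | l <= (degree G x).+1]|.
  (* The first [l] terms are at least [l - 1], and the permutation carries this count over to the
     vertices. *)
  have := count_ge_entry d_nonincreasing l_size d_bound.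
  rewrite -(seq.permP Gd) count_map -sum1_count big_enum_cond sum1_card.
  move/leq_trans; apply; apply: subset_leq_card; apply/subsetP => x.
  by rewrite !inE /=; lia.
have [|||||c cc] := @coloring_exists V (degree G) (entry d n) (entry d 1) l _ _ _ l_card k k_le_dn.
- by rewrite cardV.
- by move=> x; case/andP: (bounds x).
- by move=> x; case/andP: (bounds x).
- by [].
- by exists (fun x y => G x y : nat); apply: graph_coloring.
have [H [HG HF]] := coloring_one_factors cc.
exists V, H; split=> //; rewrite /realization.
by rewrite (eq_map HG).
Qed.
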